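(* Let $a>b>0$, let $\mathcal{E}:\ \frac{\mathsf{x}^2}{a}+\frac{\mathsf{y}^2}{b}=1$, and let $\mathcal{C}_{\lambda_0}$, $\lambda_0\in(0,b)\cup(b,a)$, be a conic confocal with $\mathcal{E}$. Suppose that real polynomials $\hat p_{2n+1}$, $\hat q_{2n-1}$ of degrees $2n+1$, $2n-1$ respectively ($n\ge 1$) satisfy the Pell equation $$\hat p_{2n+1}^2(s)-s\left(s-\frac1a\right)\left(s-\frac1b\right)\left(s-\frac1{\lambda_0}\right)\hat q_{2n-1}^2(s)=1.$$ Then there exist unique real polynomials $p_n$, $q_{n-1}$, $S_1$, $S_3$ of degrees $n$, $n-1$, $1$, $3$ respectively, such that: - $S_1$, $S_3$ are monic and $S_1S_3=s\left(s-\frac1a\right)\left(s-\frac1b\right)\left(s-\frac1{\lambda_0}\right)$; - $S_1p_n^2-S_3q_{n-1}^2$ equals $1$ or $-1$. Moreover, the billiard trajectories within $\mathcal{E}$ with caustic $\mathcal{C}_{\lambda_0}$ are all $(2n+1)$-elliptic periodic. They are $(2n+1)$-periodic if and only if $S_1(s)=s-\frac1{\lambda_0}$.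
   Context: The confocal family is $\mathcal{C}_{\lambda}:\ \frac{\mathsf{x}^2}{a-\lambda}+\frac{\mathsf{y}^2}{b-\lambda}=1$; $\mathcal{C}_\lambda$ is an ellipse for $\lambda<b$, a hyperbola for $\lambda\in(b,a)$, with degenerate members the $\mathsf{x}$-axis ($\lambda=b$) and the $\mathsf{y}$-axis ($\lambda=a$). Billiard trajectories within $\mathcal{E}$ are polygonal lines with vertices on $\mathcal{E}$ obeying the reflection law at each vertex; a trajectory has caustic $\mathcal{C}_{\lambda_0}$ if all lines containing its segments are tangent to $\mathcal{C}_{\lambda_0}$. A trajectory is $N$-periodic if it closes after $N$ reflections ($N$ not required to be minimal). Every point other than the foci lies on exactly two conics $\mathcal{C}_{\lambda_1},\mathcal{C}_{\lambda_2}$, $\lambda_1<\lambda_2$; $(\lambda_1,\lambda_2)$ are its elliptic coordinates. A trajectory is $N$-elliptic periodic if it is $N$-periodic in elliptic coordinates, i.e. the elliptic coordinates of the moving point along the trajectory repeat periodically after $N$ reflections.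
   Formalization: The uniqueness is proved as: S_1 and S_3 are unique, and p_n and q_{n-1} are unique up to sign, since replacing p_n by -p_n or q_{n-1} by -q_{n-1} gives another solution and literal uniqueness fails. *)

(* Defs.v *)
From HB Require Import structures.
From mathcomp Require Import all_boot all_order all_algebra.
From mathcomp Require Import reals.

Set Implicit Arguments.
Unset Strict Implicit.
Unset Printing Implicit Defensive.

Import Order.TTheory GRing.Theory Num.Theory.
Local Open Scope ring_scope.

Section Plane.
Variable R : realType.
Implicit Types (P A B C u v : 'rV[R]_2).

Definition xcoord P : R := P 0 0.
Definition ycoord P : R := P 0 1.
Definition point (x y : R) : 'rV[R]_2 := \row_j (if j == 0 then x else y).

Definition dotp u v : R := xcoord u * xcoord v + ycoord u * ycoord v.
Definition unit_vector u : 'rV[R]_2 := (Num.sqrt (dotp u u))^-1 *: u.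

(* Reflection in the line orthogonal to v. *)
Definition reflect v u : 'rV[R]_2 := u - (2 * dotp u v / dotp v v) *: v.

End Plane.

Section Confocal.
Variables (R : realType) (a b : R).
Implicit Types (P A B : 'rV[R]_2) (T : nat -> 'rV[R]_2).

(* The members l = a and l = b of the family are the two coordinate axes. *)
Definition on_confocal (l : R) P : Prop :=
  if l == a then xcoord P = 0
  else if l == b then ycoord P = 0
  else xcoord P ^+ 2 / (a - l) + ycoord P ^+ 2 / (b - l) = 1.

Definition elliptic_coordinates P (l1 l2 : R) : Prop :=
  [/\ l1 < l2, on_confocal l1 P & on_confocal l2 P].

(* For A != B and l distinct from a and b: the line AB is the tangent line of
   the projective closure of the conic at the point [X : Y : Z].  Points at
   infinity (Z = 0) are allowed, so the asymptotes of a hyperbola are tangent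
   to it. *)
Definition line_tangent_to_confocal (l : R) A B : Prop :=
  exists X Y Z : R,
    [/\ (X, Y, Z) <> (0, 0, 0),
        X ^+ 2 / (a - l) + Y ^+ 2 / (b - l) = Z ^+ 2,
        X * xcoord A / (a - l) + Y * ycoord A / (b - l) = Z &
        X * xcoord B / (a - l) + Y * ycoord B / (b - l) = Z].

Definition on_ellipse P : Prop :=
  xcoord P ^+ 2 / a + ycoord P ^+ 2 / b = 1.

Definition ellipse_normal P : 'rV[R]_2 := point (xcoord P / a) (ycoord P / b).

Definition billiard_trajectory T : Prop :=
  [/\ forall k, on_ellipse (T k),
      forall k, T k <> T k.+1 &
      forall k, unit_vector (T k.+2 - T k.+1)
        = reflect (ellipse_normal (T k.+1)) (unit_vector (T k.+1 - T k))].

Definition has_caustic (l : R) T : Prop :=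
  forall k, line_tangent_to_confocal l (T k) (T k.+1).

Definition periodic (N : nat) T : Prop := forall k, T (k + N)%N = T k.

Definition moving_point T (k : nat) (t : R) : 'rV[R]_2 :=
  (1 - t) *: T k + t *: T k.+1.

Definition elliptic_periodic (N : nat) T : Prop :=
  forall (k : nat) (t : R), 0 <= t <= 1 ->
    exists l1 l2 : R,
      elliptic_coordinates (moving_point T k t) l1 l2 /\
      elliptic_coordinates (moving_point T (k + N) t) l1 l2.

End Confocal.

Section Pell.
Variables (R : realType) (a b l0 : R).

Definition pell_quartic : {poly R} :=
  'X * ('X - (a^-1)%:P) * ('X - (b^-1)%:P) * ('X - (l0^-1)%:P).

Definition pell_splitting (n : nat) (p q S1 S3 : {poly R}) : Prop :=
  [/\ [/\ size p = n.+1, size q = n, size S1 = 2%N & size S3 = 4%N],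
      [/\ S1 \is monic, S3 \is monic & S1 * S3 = pell_quartic] &
      S1 * p ^+ 2 - S3 * q ^+ 2 = 1 \/ S1 * p ^+ 2 - S3 * q ^+ 2 = -1].

End Pell.

(* Main.v *)
(** For a particle at P with unit velocity V put Q_l(A,B) = <(diag(a,b) - l)^-1 A, B>
    and s = 1/l.  The matrix L(s), proportional to
    [[Q_l(P,V), Q_l(V,V)], [1 - Q_l(P,P), - Q_l(P,V)]], is polynomial in s and
    satisfies L^2 = r^2 D, with D the Pell quartic and r^2 = l0/(ab).  Free
    motion conjugates L by a constant lower unipotent matrix and reflection by
    an upper unipotent matrix linear in s; let M_k be the product of these
    matrices over k bounces.

    For N = 2n+1 the matrix U = phat + qhat L_0 / r has determinant 1, commutes
    with L_0 and has degree N.  Each bounce lowers the degree of M_k U by one,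
    so M_N U is constant.  At s = 1/a the matrix M_N carries (V_x, -P_x) to its
    value after N bounces, while L kills this vector, and at s = 0 it is lower
    unipotent; similarly at s = 1/b.  Comparing these values, N bounces multiply
    x by phat(0) phat(1/a) and y by phat(0) phat(1/b), which are signs.

    On the algebraic side, (phat + 1)(phat - 1) = D qhat^2 with coprime factors
    of odd degree, so one of them is, up to a scalar, S1 p^2 and the other
    S3 q^2.  Hence phat takes at the root of S1 the opposite of its value at
    the other three roots of D, and the two signs above are both 1 exactly
    when that root is 1/l0. *)

Require Import Defs.
From HB Require Import structures.
From mathcomp Require Import all_boot all_order all_algebra.
From mathcomp Require Import reals.
From mathcomp Require Import ring lra zify.

Set Implicit Arguments.
Unset Strict Implicit.
Unset Printing Implicit Defensive.

Import Order.TTheory GRing.Theory Num.Theory.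
Local Open Scope ring_scope.

(** * Lax matrix of a billiard in a conic *)

Section LaxMatrix.
Variables (R : comNzRingType) (ia ib : R).
Implicit Types (x y u v t m : R) (f g : {poly R}).

(* For a particle at [(x, y)] with velocity [(u, v)], the matrix
   [[lax_al, lax_be], [lax_ga, - lax_al]] is ('X - 1/a) ('X - 1/b) times
   [[Q(P,V), Q(V,V)], [1 - Q(P,P), - Q(P,V)]], where Q is the bilinear form of
   the confocal conic of parameter [1 / 'X], [ia = 1/a] and [ib = 1/b]. *)
Definition lax_al x y u v : {poly R} :=
  (x * u * ia + y * v * ib)%:P * 'X ^+ 2
  - (ia * ib * (x * u + y * v))%:P * 'X.
Definition lax_be u v : {poly R} :=
  (u ^+ 2 * ia + v ^+ 2 * ib)%:P * 'X ^+ 2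
  - (ia * ib * (u ^+ 2 + v ^+ 2))%:P * 'X.
Definition lax_ga x y : {poly R} :=
  (1 - x ^+ 2 * ia - y ^+ 2 * ib)%:P * 'X ^+ 2
  - (ia + ib - ia * ib * (x ^+ 2 + y ^+ 2))%:P * 'X + (ia * ib)%:P.

Lemma lax_al_motion x y u v t :
  lax_al (x + t * u) (y + t * v) u v = lax_al x y u v + t%:P * lax_be u v.
Proof. rewrite /lax_al /lax_be. ring. Qed.

Lemma lax_ga_motion x y u v t :
  lax_ga (x + t * u) (y + t * v) =
  lax_ga x y - 2 * t%:P * lax_al x y u v - t%:P ^+ 2 * lax_be u v.
Proof. rewrite /lax_al /lax_be /lax_ga. ring. Qed.

(** Serves to prove ring identities modulo a hypothesis: the difference is a cofactor times a
    vanishing quantity. *)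
Lemma eq_sub_mul0 (V : pzRingType) (p q c d : V) : p - q = c * d -> d = 0 -> p = q.
Proof. by move=> h d0; apply/eqP; rewrite -subr_eq0 h d0 mulr0. Qed.

(** A bounce adds m N to the velocity, N being the normal (x ia, y ib). Partial fractions give
    Q(P,N) = 'X (Q(P,P) - 1) on the ellipse. *)
Lemma lax_al_bounce x y u v m : x ^+ 2 * ia + y ^+ 2 * ib = 1 ->
  lax_al x y (u + m * x * ia) (v + m * y * ib) =
  lax_al x y u v - m%:P * 'X * lax_ga x y.
Proof.
move=> he.
apply: (@eq_sub_mul0 _ _ _ (m%:P * 'X * ('X - ia%:P) * ('X - ib%:P))
   (1 - x ^+ 2 * ia - y ^+ 2 * ib)%:P); last by rewrite -he -addrA -opprD subrr.
rewrite /lax_al /lax_ga; ring.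
Qed.

(** Expanding Q(V + mN, V + mN) by the same partial fractions leaves, besides the ellipse equation,
    a multiple of the change of squared speed. *)
Lemma lax_be_bounce x y u v m : x ^+ 2 * ia + y ^+ 2 * ib = 1 ->
  (u + m * x * ia) ^+ 2 + (v + m * y * ib) ^+ 2 = u ^+ 2 + v ^+ 2 ->
  lax_be (u + m * x * ia) (v + m * y * ib) =
  lax_be u v + 2 * m%:P * 'X * lax_al x y u v - (m%:P * 'X) ^+ 2 * lax_ga x y.
Proof.
move=> he hw; pose w := (u + m * x * ia) ^+ 2 + (v + m * y * ib) ^+ 2 - (u ^+ 2 + v ^+ 2).
have hw0 : w = 0 by rewrite /w hw subrr.
apply: (@eq_sub_mul0 _ _ _ ((m%:P * 'X) ^+ 2 * ('X - ia%:P) * ('X - ib%:P))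
   (1 - x ^+ 2 * ia - y ^+ 2 * ib)%:P); last by rewrite -he -addrA -opprD subrr.
apply: (@eq_sub_mul0 _ _ _ (- 'X * ('X - ia%:P) * ('X - ib%:P)) w%:P); last by rewrite hw0.
rewrite /w /lax_be /lax_al /lax_ga; ring.
Qed.

(** Lagrange's identity turns Q(P,V)^2 - Q(P,P) Q(V,V) into a multiple of the squared moment
    [x * v - y * u]. *)
Lemma lax_det x y u v :
  lax_al x y u v ^+ 2 + lax_be u v * lax_ga x y =
  'X * ('X - ia%:P) * ('X - ib%:P) *
  ((u ^+ 2 * ia + v ^+ 2 * ib - ia * ib * (x * v - y * u) ^+ 2)%:P * 'X
   - (ia * ib * (u ^+ 2 + v ^+ 2))%:P).
Proof. rewrite /lax_be /lax_al /lax_ga; ring. Qed.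

End LaxMatrix.

(** * Degrees and top coefficients of products *)

Section PolyCoef.
Variable R : nzRingType.
Implicit Types p q : {poly R}.

Lemma coefM_top p q i j :
  (size p <= i.+1)%N -> (size q <= j.+1)%N -> (p * q)`_(i + j) = p`_i * q`_j.
Proof.
move=> hp hq; rewrite coefM (bigD1 (inord i)) //= inordK ?ltnS ?leq_addr //.
rewrite addKn big1 ?addr0 // => k; rewrite -val_eqE /= inordK ?ltnS ?leq_addr // => ki.
have [kl|kg] := ltnP i k; first by rewrite (nth_default 0 (leq_trans hp kl)) mul0r.
rewrite [q`__]nth_default ?mulr0 // (leq_trans hq) //.
by move: ki kg => /eqP; lia.
Qed.

Lemma size_mul_leqS p q i j :
  (size p <= i.+1)%N -> (size q <= j.+1)%N -> (size (p * q)%R <= (i + j).+1)%N.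
Proof.
move=> hp hq; rewrite (leq_trans (size_polyMleq _ _)) //.
by rewrite -subn1 leq_subLR (leq_trans (leq_add hp hq)) // addSn addnS.
Qed.

Lemma size_leS p i : (size p <= i.+1)%N -> p`_i = 0 -> (size p <= i)%N.
Proof.
move=> sp p0; rewrite leqNgt; apply/negP => lt.
have e : size p = i.+1 by apply/eqP; rewrite eqn_leq sp.
have : lead_coef p == 0 by rewrite lead_coefE e p0.
by rewrite lead_coef_eq0 => /eqP p00; move: e; rewrite p00 size_poly0.
Qed.

Lemma horner_size1 p z z' : (size p <= 1)%N -> p.[z] = p.[z'].
Proof. by move=> /size1_polyC ->; rewrite !hornerC. Qed.

End PolyCoef.

(** * Monodromy of an orbit and the Pell equation *)

Section Orbit.
Variables (R : realFieldType) (ia ib il r : R).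
(** [(x k, y k)] is a vertex, [(u k, v k)] the unit velocity leaving it, [t k] the length of the
    segment that follows, [m k] the multiple of the normal added at the bounce ending it. *)
Variables (x y u v t m : nat -> R).
Hypothesis r_gt0 : 0 < r.
Hypothesis il_r : il * r ^+ 2 = ia * ib.
Hypothesis x_motion : forall k, x k.+1 = x k + t k * u k.
Hypothesis y_motion : forall k, y k.+1 = y k + t k * v k.
Hypothesis u_bounce : forall k, u k.+1 = u k + m k * x k.+1 * ia.
Hypothesis v_bounce : forall k, v k.+1 = v k + m k * y k.+1 * ib.
Hypothesis xy_ellipse : forall k, x k ^+ 2 * ia + y k ^+ 2 * ib = 1.
Hypothesis uv_unit : forall k, u k ^+ 2 + v k ^+ 2 = 1.
Hypothesis uv_out : forall k, x k * u k * ia + y k * v k * ib = - r.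
Hypothesis uv_hit : forall k, t k * (u k ^+ 2 * ia + v k ^+ 2 * ib) = 2 * r.
Hypothesis joachimsthal : forall k,
  u k ^+ 2 * ia + v k ^+ 2 * ib - ia * ib * (x k * v k - y k * u k) ^+ 2
  = r ^+ 2.

Let al k := lax_al ia ib (x k) (y k) (u k) (v k).
Let be k := lax_be ia ib (u k) (v k).
Let ga k := lax_ga ia ib (x k) (y k).

Definition lax_apply k (w : {poly R} * {poly R}) :=
  (al k * w.1 + be k * w.2, ga k * w.1 - al k * w.2).

(* At ['X = 1/a] this linear step sends [(u k, - x k)] to
   [(u k.+1, - x k.+1)], and likewise for [(v, - y)] at ['X = 1/b]. *)
Definition orbit_step k (w : {poly R} * {poly R}) :=
  let g := w.2 - (t k)%:P * w.1 in (w.1 - (m k)%:P * 'X * g, g).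

Fixpoint monodromy k (w : {poly R} * {poly R}) :=
  if k is k'.+1 then orbit_step k' (monodromy k' w) else w.

Lemma lax_apply_step k w :
  lax_apply k.+1 (orbit_step k w) = orbit_step k (lax_apply k w).
Proof.
have ha : al k.+1 = al k + (t k)%:P * be k - (m k)%:P * 'X * ga k.+1.
  rewrite {1}/al u_bounce v_bounce lax_al_bounce ?xy_ellipse //.
  by rewrite x_motion y_motion lax_al_motion -x_motion -y_motion.
have hb : be k.+1 = be k + 2 * (m k)%:P * 'X * (al k + (t k)%:P * be k)
      - ((m k)%:P * 'X) ^+ 2 * ga k.+1.
  rewrite {1}/be u_bounce v_bounce (@lax_be_bounce _ _ _ (x k.+1) (y k.+1)) ?xy_ellipse //.
    by rewrite [in lax_al _ _ _ _ _ _]x_motion [in lax_al _ _ _ _ _ _]y_motion lax_al_motion.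
  by rewrite -u_bounce -v_bounce !uv_unit.
have hg : ga k.+1 = ga k - 2 * (t k)%:P * al k - (t k)%:P ^+ 2 * be k.
  by rewrite /ga x_motion y_motion lax_ga_motion.
rewrite /lax_apply /orbit_step /=; congr (_, _); rewrite ?ha ?hb hg; ring.
Qed.

Variables (N : nat) (ph qh : {poly R}).
Hypothesis N_gt1 : (1 < N)%N.
Hypothesis size_ph : size ph = N.+1.
Hypothesis size_qh : size qh = N.-1.
(** Pell gives this up to sign. With this sign the top terms of [r%:P * ph + qh * al k] cancel, as
    [al k] has leading coefficient [- r]. *)
Hypothesis lead_pq : ph`_N = qh`_(N - 2).
Hypothesis pell : ph ^+ 2 -
  'X * ('X - ia%:P) * ('X - ib%:P) * ('X - il%:P) * qh ^+ 2 = 1.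

(** The matrix r phat + qhat L, that is U scaled by r to avoid a division. *)
Definition pell_apply k (w : {poly R} * {poly R}) :=
  (r%:P * ph * w.1 + qh * (lax_apply k w).1,
   r%:P * ph * w.2 + qh * (lax_apply k w).2).

Lemma lax_sqr k :
  al k ^+ 2 + be k * ga k =
  (r ^+ 2)%:P * ('X * ('X - ia%:P) * ('X - ib%:P) * ('X - il%:P)).
Proof. rewrite lax_det joachimsthal uv_unit -il_r; ring. Qed.

(** The conjugate r phat - qhat L inverts [pell_apply] up to the factor r^2, because L^2 = r^2 D and
    phat^2 - D qhat^2 = 1. *)
Lemma pell_applyK k w (f := pell_apply k w) :
  r%:P * ph * f.1 - qh * (al k * f.1 + be k * f.2) = (r ^+ 2)%:P * w.1 /\
  r%:P * ph * f.2 - qh * (ga k * f.1 - al k * f.2) = (r ^+ 2)%:P * w.2.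
Proof.
have e (z : {poly R}) : (r ^+ 2)%:P * z =
    (r%:P ^+ 2 * ph ^+ 2 - (al k ^+ 2 + be k * ga k) * qh ^+ 2) * z.
  by rewrite lax_sqr -[in LHS](mulr1 (r ^+ 2)%:P) -pell; ring.
by rewrite /f /pell_apply /lax_apply /= !e; split; ring.
Qed.

Lemma pell_apply_step k w :
  pell_apply k.+1 (orbit_step k w) = orbit_step k (pell_apply k w).
Proof.
rewrite /pell_apply lax_apply_step /orbit_step /=; congr (_, _); ring.
Qed.

Let size_al k : (size (al k) <= 3)%N.
Proof.
apply/leq_sizeP => -[|[|[|j]]] // _.
by rewrite /al /lax_al coefB !coefCM coefXn coefX !mulr0 subr0.
Qed.

Let size_be k : (size (be k) <= 3)%N.
Proof.
apply/leq_sizeP => -[|[|[|j]]] // _.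
by rewrite /be /lax_be coefB !coefCM coefXn coefX !mulr0 subr0.
Qed.

Let size_ga k : (size (ga k) <= 2)%N.
Proof.
apply/leq_sizeP => -[|[|j]] // _.
rewrite /ga /lax_ga coefD coefB !coefCM coefXn coefX coefC /=.
case: j => [|j]; last by rewrite !mulr0 subr0 addr0.
(* Vertices lie on the ellipse, which kills the coefficient of ['X ^+ 2]. *)
by rewrite -(xy_ellipse k); ring.
Qed.

Let al2 k : (al k)`_2 = - r.
Proof. by rewrite /al /lax_al coefB !coefCM coefXn coefX /= uv_out; ring. Qed.

Let be2 k : t k * (be k)`_2 = 2 * r.
Proof. by rewrite /be /lax_be coefB !coefCM coefXn coefX /= -(uv_hit k); ring. Qed.

Let lead_ph_neq0 : ph`_N != 0.
Proof.
have -> : ph`_N = lead_coef ph by rewrite lead_coefE size_ph.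
by rewrite lead_coef_eq0 -size_poly_eq0 size_ph.
Qed.

(* The left-hand side of [pell_applyK] has no term of degree [N + d]. *)
Lemma pell_apply_top k d w (f := pell_apply k w) :
  (size w.1 <= d + N)%N -> (size f.1 <= d.+1)%N -> (size f.2 <= d.+1)%N ->
  2 * r * f.1`_d = (be k)`_2 * f.2`_d.
Proof.
move=> sw; have [] := pell_applyK k w; rewrite -/f => h _; move: f h => f h s1 s2; move: h.
move/(congr1 (fun p : {poly R} => p`_(N + d))).
rewrite coefB -!mulrA !coefCM (nth_default 0 (_ : (size w.1 <= N + d)%N)); last by rewrite addnC.
rewrite coefM_top ?size_ph //.
have -> : (N + d = (N - 2) + (2 + d))%N by lia.
rewrite (@coefM_top _ qh) ?size_qh; first last.
- by rewrite (leq_trans (size_polyD _ _)) // geq_max !size_mul_leqS.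
- by lia.
rewrite coefD !coefM_top // al2 -lead_pq mulr0 => h.
apply: (mulfI lead_ph_neq0); apply/eqP; rewrite -subr_eq0; apply/eqP; rewrite -[RHS]h; ring.
Qed.

Lemma size_monodromy k e1 e2 (w := monodromy k (e1%:P, e2%:P)) :
  (size w.1 <= k.+1)%N /\ (size w.2 <= k.+1)%N.
Proof.
rewrite /w; elim: k {w} => [|k [IH1 IH2]] /=; first by rewrite !size_polyC; do 2?case: eqP.
set w := monodromy _ _ in IH1 IH2 *.
have sg : (size (w.2 - (t k)%:P * w.1)%R <= k.+1)%N.
  rewrite (leq_trans (size_polyD _ _)) // size_polyN geq_max IH2 mul_polyC.
  exact: leq_trans (size_scale_leq _ _) IH1.
split; last exact: leqW.
rewrite (leq_trans (size_polyD _ _)) // size_polyN geq_max leqW //=.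
rewrite -mulrA mul_polyC (leq_trans (size_scale_leq _ _)) //.
by rewrite (leq_trans (size_polyMleq _ _)) // size_polyX.
Qed.

(* The monodromy raises degrees by at most one per step; applied after
   [ph + qh L / r] it lowers them by one per step, because outgoing velocities
   give Q_0(P,V) = - r, the sign opposite to the eigenvalue of the leading
   coefficient. *)
Lemma size_pell_apply k e1 e2 (f := pell_apply k (monodromy k (e1%:P, e2%:P))) :
  (k <= N)%N -> (size f.1 <= (N - k).+1)%N /\ (size f.2 <= (N - k).+1)%N.
Proof.
rewrite /f {f}; elim: k => [_|k IH kN].
  have sC (c : R) (p : {poly R}) j : (size p <= j)%N -> (size (p * c%:P)%R <= j)%N.
    by move=> sp; rewrite mulrC mul_polyC (leq_trans (size_scale_leq _ _)).
  have sq (z : {poly R}) c : (size z <= 3)%N ->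
      (size (r%:P * ph * c%:P + qh * z)%R <= N.+1)%N.
    move=> sz; rewrite (leq_trans (size_polyD _ _)) // geq_max.
    rewrite sC; last by rewrite mulrC sC ?size_ph.
    by rewrite (leq_trans (size_polyMleq _ _)) // size_qh; lia.
  rewrite subn0 /= !sq // (leq_trans (size_polyD _ _)) ?size_polyN // geq_max.
    by rewrite !sC // (leq_trans (size_ga _)).
  by rewrite !sC.
have [] := IH (ltnW kN); have [] := size_monodromy k.+1 e1 e2; have [] := size_monodromy k e1 e2.
rewrite (pell_apply_step k (monodromy k (e1%:P, e2%:P))) -/(monodromy k.+1 _).
set w := monodromy k _; set f := pell_apply k w; rewrite /orbit_step.
move=> sw1 sw2 sw1' sw2' sf1 sf2.
have topk : 2 * r * f.1`_(N - k) = (be k)`_2 * f.2`_(N - k).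
  by apply: pell_apply_top; rewrite ?(leq_trans sw1) //; lia.
have r2 : 2 * r != 0 by rewrite mulf_neq0 ?pnatr_eq0 ?gt_eqF.
(* Since [t k] times the top coefficient of [be k] is [2 * r], the flight cancels the coefficient of
   degree [N - k]. *)
have sg : (size (f.2 - (t k)%:P * f.1)%R <= N - k)%N.
  apply: size_leS.
    rewrite (leq_trans (size_polyD _ _)) // size_polyN geq_max sf2 mul_polyC.
    exact: leq_trans (size_scale_leq _ _) sf1.
  apply: (mulfI r2); rewrite mulr0 coefB coefCM mulrBr mulrCA topk mulrA be2; ring.
have sf' : (size (f.1 - (m k)%:P * 'X * (f.2 - (t k)%:P * f.1))%R <= (N - k).+1)%N.
  rewrite (leq_trans (size_polyD _ _)) // size_polyN geq_max sf1 /=.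
  rewrite -mulrA mul_polyC (leq_trans (size_scale_leq _ _)) //.
  by rewrite (leq_trans (size_polyMleq _ _)) // size_polyX.
have -> : ((N - k.+1).+1 = N - k)%N by lia.
split=> //; apply: size_leS => //.
(* The same relation at the next vertex: the second component has lost its term of degree [N - k],
   hence so has the first. *)
have := @pell_apply_top k.+1 (N - k) (orbit_step k w).
rewrite pell_apply_step /= => /(_ _ sf' (leqW sg)) h.
apply: (mulfI r2); rewrite mulr0 h ?(nth_default _ sg) ?mulr0 //.
by rewrite (leq_trans sw1') //; lia.
Qed.

(** Bounces are trivial at ['X = 0], so only the flights remain and [c] is the total length
    travelled. *)
Lemma monodromy_at0 k : exists c, forall e1 e2,
  let w := monodromy k (e1%:P, e2%:P) in w.1.[0] = e1 /\ w.2.[0] = e2 - c * e1.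
Proof.
elim: k => [|k [c IH]].
  by exists 0 => e1 e2 /=; rewrite !hornerC mul0r subr0.
exists (c + t k) => e1 e2 /=; have [h1 h2] := IH e1 e2.
by rewrite !hornerE h1 h2; split; ring.
Qed.

Lemma monodromy_ata k :
  let w := monodromy k ((u 0)%:P, (- x 0)%:P) in w.1.[ia] = u k /\ w.2.[ia] = - x k.
Proof.
elim: k => [|k /= [h1 h2]] /=; first by rewrite !hornerC.
rewrite !hornerE h1 h2 u_bounce !x_motion; split; ring.
Qed.

Lemma monodromy_atb k :
  let w := monodromy k ((v 0)%:P, (- y 0)%:P) in w.1.[ib] = v k /\ w.2.[ib] = - y k.
Proof.
elim: k => [|k /= [h1 h2]] /=; first by rewrite !hornerC.
rewrite !hornerE h1 h2 v_bounce !y_motion; split; ring.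
Qed.

Let lax_hornerE :=
  (@hornerD R, @hornerN R, @hornerM R, @hornerXn R, @hornerX R, @hornerC R).

Lemma orbit_return :
  x N = ph.[0] * ph.[ia] * x 0 /\ y N = ph.[0] * ph.[ib] * y 0.
Proof.
have r0 : r != 0 by rewrite gt_eqF.
have sq z : z * (z - ia) * (z - ib) * (z - il) = 0 -> ph.[z] ^+ 2 = 1.
  move=> z0; have := congr1 (horner^~ z) pell.
  by rewrite hornerD hornerN horner_exp !hornerM !hornerXsubC hornerX hornerC z0 !mul0r subr0.
have s0 : ph.[0] ^+ 2 = 1 by apply: sq; ring.
have sa : ph.[ia] ^+ 2 = 1 by apply: sq; ring.
have sb : ph.[ib] ^+ 2 = 1 by apply: sq; ring.
have [c hc] := monodromy_at0 N.
(* At 0 the only nonzero entry of L is [ga], equal to [ia * ib]; [c'] absorbs its contribution,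
   using [s0]. *)
pose c' := c - qh.[0] * (ia * ib) * ph.[0] / r.
have at0 e1 e2 : let f := pell_apply N (monodromy N (e1%:P, e2%:P)) in
    f.1.[0] = r * ph.[0] * e1 /\ f.2.[0] = r * ph.[0] * (e2 - c' * e1).
  have [h1 h2] := hc e1 e2.
  rewrite /= /al /be /ga /lax_al /lax_be /lax_ga !lax_hornerE h1 h2 /c'; split; first ring.
  transitivity (r * ph.[0] * (e2 - c * e1) + ph.[0] ^+ 2 * (qh.[0] * (ia * ib * e1))).
    by rewrite s0; ring.
  by field.
(* [pell_apply N \o monodromy N] is constant in 'X: compare 'X = 0 with 'X = 1/a, 1/b. *)
have const e1 e2 z : let f := pell_apply N (monodromy N (e1%:P, e2%:P)) in
    f.1.[z] = r * ph.[0] * e1 /\ f.2.[z] = r * ph.[0] * (e2 - c' * e1).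
  have [] := @size_pell_apply N e1 e2 (leqnn _); rewrite subnn => s1 s2.
  by have [<- <-] := at0 e1 e2; split; apply: horner_size1.
have cancel p e e' : p ^+ 2 = 1 -> r * p * e = r * ph.[0] * e' -> e = ph.[0] * p * e'.
  move=> p2 h; apply: (mulfI r0); rewrite -[LHS]mulr1 -p2.
  transitivity (p * (r * p * e)); first ring.
  by rewrite h; ring.
(* At [ia] the Lax matrix kills [(u N, - x N)], so [pell_apply] multiplies this vector by [r *
   ph.[ia]]. *)
have [hu1 hx1] : u N = ph.[0] * ph.[ia] * u 0 /\ x N = ph.[0] * ph.[ia] * (x 0 + c' * u 0).
  have [h1 h2] := const (u 0) (- x 0) ia; have [w1 w2] := monodromy_ata N.
  split; apply: cancel => //.
    rewrite -h1 /= /al /be /ga /lax_al /lax_be /lax_ga !lax_hornerE w1 w2; ring.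
  apply: oppr_inj; rewrite -mulrN -[- (_ * _)]mulrN.
  have -> : - (x 0 + c' * u 0) = - x 0 - c' * u 0 by ring.
  rewrite -h2 /= /al /be /ga /lax_al /lax_be /lax_ga !lax_hornerE w1 w2; ring.
have [hv1 hy1] : v N = ph.[0] * ph.[ib] * v 0 /\ y N = ph.[0] * ph.[ib] * (y 0 + c' * v 0).
  have [h1 h2] := const (v 0) (- y 0) ib; have [w1 w2] := monodromy_atb N.
  split; apply: cancel => //.
    rewrite -h1 /= /al /be /ga /lax_al /lax_be /lax_ga !lax_hornerE w1 w2; ring.
  apply: oppr_inj; rewrite -mulrN -[- (_ * _)]mulrN.
  have -> : - (y 0 + c' * v 0) = - y 0 - c' * v 0 by ring.
  rewrite -h2 /= /al /be /ga /lax_al /lax_be /lax_ga !lax_hornerE w1 w2; ring.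
(* Up to signs the orbit would return displaced by [c'] along its velocity. Comparing Q_0(P,V) = - r
   at both ends gives c' Q_0(V,V) = 0. *)
have c0 : c' = 0.
  have := uv_out N; rewrite hx1 hu1 hy1 hv1.
  have sq4 (z p w w' q : R) : z * p * w * (z * p * w') * q = z ^+ 2 * p ^+ 2 * (w * w' * q).
    by ring.
  rewrite !sq4 s0 sa sb !mul1r => h.
  have /eqP : c' * (u 0 ^+ 2 * ia + v 0 ^+ 2 * ib) = 0.
    by apply: (@addrI _ (- r)); rewrite -{1}(uv_out 0) addr0 -h; ring.
  rewrite mulf_eq0 => /orP[/eqP//|/eqP b0].
  by have := uv_hit 0; rewrite b0 mulr0 => /esym/eqP; rewrite mulf_eq0 pnatr_eq0 (negPf r0).
by rewrite hx1 hy1 c0 !mul0r !addr0.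
Qed.

End Orbit.

(** * Splitting a solution of the Pell equation *)

(** For d = gcd(A, q), coprimality with B gives d^2 | A, and coprimality of A/d and q/d gives A |
    d^2. *)
Lemma coprimep_mul_sqr (F : fieldType) (A B q : {poly F}) :
  q != 0 -> coprimep A B -> A * B = q ^+ 2 ->
  exists2 g, g \is monic & A = lead_coef A *: g ^+ 2.
Proof.
move=> q0 cAB e.
have AB0 : A * B != 0 by rewrite e expf_neq0.
have A0 : A != 0 by apply: contraNneq AB0 => ->; rewrite mul0r.
pose d := gcdp A q.
have d0 : d != 0 by rewrite gcdp_eq0 (negPf A0).
have dA : d ^+ 2 %| A.
  rewrite -(@Gauss_dvdpl _ _ B) ?e ?dvdp_exp2r ?dvdp_gcdr //.
  by rewrite coprimep_expl // (coprimep_dvdr (dvdp_gcdl A q)).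
have Ad : A %| d ^+ 2.
  have eA : A = A %/ d * d by rewrite divpK ?dvdp_gcdl.
  have eq : q = q %/ d * d by rewrite divpK ?dvdp_gcdr.
  rewrite eA expr2 dvdp_mul2r // -(@Gauss_dvdpl _ _ ((q %/ d) ^+ 2)); last first.
    by rewrite coprimep_expr // coprimep_div_gcd // A0.
  suff -> : d * (q %/ d) ^+ 2 = A %/ d * B by rewrite dvdp_mulr.
  by apply: (mulIf d0); rewrite [RHS]mulrAC -eA e [in RHS]eq; ring.
have /eqpP[[c1 c2] /= /andP[c10 c20] h] : A %= d ^+ 2 by rewrite /eqp Ad dA.
have ld : lead_coef d != 0 by rewrite lead_coef_eq0.
exists ((lead_coef d)^-1 *: d); first by rewrite monicE lead_coefZ mulVf.
have -> : A = (c2 / c1) *: d ^+ 2.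
  by rewrite mulrC -scalerA -h scalerA mulVf ?scale1r.
rewrite lead_coefZ lead_coef_exp exprZn !scalerA; congr (_ *: _).
by rewrite -mulrA exprVn mulfV ?mulr1 ?expf_neq0.
Qed.

Lemma eq_or_oppr_sqr (F : idomainType) (p q : F) : p ^+ 2 = q ^+ 2 -> p = q \/ p = - q.
Proof. by move/eqP; rewrite eqf_sqr => /orP[/eqP|/eqP]; [left|right]. Qed.

(** Identifies the Pell solution built from a splitting with the given one. *)
Lemma pell_unique (R : numFieldType) (D p1 q1 p2 q2 : {poly R}) m :
  size p1 = m.+3 -> size p2 = m.+3 -> size q1 = m.+1 -> size q2 = m.+1 ->
  p1 ^+ 2 - D * q1 ^+ 2 = 1 -> p2 ^+ 2 - D * q2 ^+ 2 = 1 ->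
  p1 = p2 \/ p1 = - p2.
Proof.
move=> sp1 sp2 sq1 sq2 h1 h2.
have nz (p : {poly R}) k : size p = k.+1 -> p != 0 by move=> h; rewrite -size_poly_eq0 h.
pose f := p1 * q2 - p2 * q1; pose g := p1 * q2 + p2 * q1.
(* [f + g] has degree [2 m + 2] and [f * g] at most [2 m], so [f * g = 0]. *)
have efg : f * g = q2 ^+ 2 - q1 ^+ 2.
  transitivity ((p1 ^+ 2 - D * q1 ^+ 2) * q2 ^+ 2 - (p2 ^+ 2 - D * q2 ^+ 2) * q1 ^+ 2).
    by rewrite /f /g; ring.
  by rewrite h1 h2 !mul1r.
have sfg : (size (f * g)%R <= (m + m).+1)%N.
  have sz (q : {poly R}) : size q = m.+1 -> (size (q ^+ 2)%R <= (m + m).+1)%N.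
    by move=> sq; rewrite expr2 (leq_trans (size_polyMleq _ _)) // sq addnS.
  by rewrite efg (leq_trans (size_polyD _ _)) // size_polyN geq_max !sz.
have [fg0|fg0] := eqVneq (f * g) 0.
  apply: eq_or_oppr_sqr.
  have e : q2 ^+ 2 = q1 ^+ 2 by apply/eqP; rewrite -subr_eq0 -efg fg0.
  rewrite -[LHS](subrK (D * q1 ^+ 2)) h1 -{1}e -h2; ring.
have [f0 g0] : f != 0 /\ g != 0 by apply/andP; rewrite -negb_or -mulf_eq0.
have : (size ((2%:R : R) *: (p1 * q2))%R <= maxn (size f) (size g))%N.
  rewrite (_ : _ *: _ = f + g) ?size_polyD // /f /g scaler_nat; ring.
rewrite size_scale ?pnatr_eq0 // size_mul ?sp1 ?sq2 ?(nz _ _ sp1) ?(nz _ _ sq2) //.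
move: sfg; rewrite size_mul //; move: f0 g0; rewrite -!size_poly_gt0.
move: (size f) (size g); lia.
Qed.

(** Parity count: both factors phat + 1 and phat - 1 have odd degree, so the quartic splits into odd
    degrees 1 + 3. *)
Lemma splitting_sizes (k sg sh sS sS' : nat) :
  (0 < k -> 0 < sg -> 0 < sh -> 0 < sS -> 0 < sS' ->
  2 * k + 2 = (2 * sg.-1).+1 + sS.-1 -> 2 * k + 2 = (2 * sh.-1).+1 + sS'.-1 ->
  5 = (sS + sS').-1 ->
  sS = 2 /\ sS' = 4 /\ sg = k.+1 /\ sh = k \/
  sS = 4 /\ sS' = 2 /\ sg = k /\ sh = k.+1)%N.
Proof. lia. Qed.

Section Splitting.
Variables (R : realType) (a b l0 : R).

Definition quartic_roots : seq R := [:: 0; a^-1; b^-1; l0^-1].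

Lemma pell_quarticE :
  pell_quartic a b l0 = \prod_(z <- quartic_roots) ('X - z%:P).
Proof. by rewrite !big_cons big_nil mulr1 polyC0 subr0 !mulrA. Qed.

Lemma root_pell_quartic z : root (pell_quartic a b l0) z = (z \in quartic_roots).
Proof. by rewrite pell_quarticE root_prod_XsubC. Qed.

Variables (n : nat) (ph qh : {poly R}).
Hypothesis uniq_roots : uniq quartic_roots.
Hypothesis n_gt0 : (0 < n)%N.
Hypothesis size_ph : size ph = (2 * n + 2)%N.
Hypothesis size_qh : size qh = (2 * n)%N.
Hypothesis pell : ph ^+ 2 - pell_quartic a b l0 * qh ^+ 2 = 1.

Lemma pell_at_root z : z \in quartic_roots -> ph.[z] = 1 \/ ph.[z] = - 1.
Proof.
rewrite -root_pell_quartic => /rootP h; apply: eq_or_oppr_sqr.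
have := congr1 (horner^~ z) pell.
by rewrite hornerD hornerN horner_exp hornerM h mul0r subr0 hornerC expr1n.
Qed.

(** Absorbing c/2 into the squares requires the square root of its absolute value; the sign of c
    remains as the 1 or -1. *)
Lemma pell_splitting_normalize (g h S S' : {poly R}) (c : R) :
  c != 0 -> g \is monic -> h \is monic -> S \is monic -> S' \is monic ->
  size g = n.+1 -> size h = n -> size S = 2%N -> size S' = 4%N ->
  S * S' = pell_quartic a b l0 ->
  S * (c *: g ^+ 2) - S' * (c *: h ^+ 2) = 2 ->
  exists p q S1 S3 : {poly R}, pell_splitting a b l0 n p q S1 S3.
Proof.
move=> c0 mg mh mS mS' sg sh sS sS' eSS e.
pose k := Num.sqrt (`|c| / 2).
have k0 : k != 0 by rewrite sqrtr_eq0 -ltNge divr_gt0 ?normr_gt0.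
exists (k *: g), (k *: h), S, S'; split => //; first by rewrite !size_scale.
have -> : S * (k *: g) ^+ 2 - S' * (k *: h) ^+ 2 = (Num.sg c)%:P.
  have -> : S * (k *: g) ^+ 2 - S' * (k *: h) ^+ 2 =
      (k ^+ 2 / c) *: (S * (c *: g ^+ 2) - S' * (c *: h ^+ 2)).
    by rewrite !exprZn -!scalerAr scalerBr !scalerA divfK.
  have -> : S * (c *: g ^+ 2) - S' * (c *: h ^+ 2) = (2 : R)%:P by rewrite e polyC_natr.
  rewrite sqr_sqrtr ?divr_ge0 // normrEsg -mul_polyC -polyCM; congr _%:P.
  by field.
by case: sgrP c0 => // _ _; [left|right; rewrite polyCN].
Qed.

Lemma pell_splitting_exists :
  exists p q S1 S3 : {poly R}, pell_splitting a b l0 n p q S1 S3.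
Proof.
(* [S] gathers the roots of the quartic dividing phat + 1, [S'] those dividing phat - 1. *)
pose S := \prod_(z <- quartic_roots | ph.[z] == -1) ('X - z%:P).
pose S' := \prod_(z <- quartic_roots | ph.[z] != -1) ('X - z%:P).
have eSS : S * S' = pell_quartic a b l0.
  by rewrite pell_quarticE [RHS](bigID (fun z => ph.[z] == -1)).
have mS : S \is monic by apply: monic_prod_XsubC.
have mS' : S' \is monic by apply: monic_prod_XsubC.
have dS : S %| ph + 1.
  rewrite /S -big_filter; apply: uniq_roots_dvdp; last by rewrite uniq_rootsE filter_uniq.
  apply/allP => z; rewrite mem_filter => /andP[/eqP h _].
  by apply/rootP; rewrite hornerD hornerC h addNr.
have dS' : S' %| ph - 1.
  rewrite /S' -big_filter; apply: uniq_roots_dvdp; last by rewrite uniq_rootsE filter_uniq.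
  apply/allP => z; rewrite mem_filter => /andP[/eqP h /pell_at_root [h'|//]].
  by apply/rootP; rewrite hornerD hornerN hornerC h' subrr.
clearbody S S'.
have /dvdpP[A eA] := dS; have /dvdpP[B eB] := dS'.
have size1 : (1 < size ph)%N by rewrite size_ph; lia.
have sp1 : size (ph + 1) = size ph by rewrite size_polyDl ?size_poly1.
have sm1 : size (ph - 1) = size ph by rewrite size_polyDl ?size_polyN ?size_poly1.
have lp1 : lead_coef (ph + 1) = lead_coef ph by rewrite lead_coefDl ?size_poly1.
have lm1 : lead_coef (ph - 1) = lead_coef ph by rewrite lead_coefDl ?size_polyN ?size_poly1.
have eAB : A * B = qh ^+ 2.
  apply: (mulfI (mulf_neq0 (monic_neq0 mS) (monic_neq0 mS'))).
  have -> : S * S' * (A * B) = (A * S) * (B * S') by ring.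
  rewrite -eA -eB eSS; transitivity (ph ^+ 2 - 1); first ring.
  by rewrite -pell; ring.
have cpm : coprimep (ph + 1) (ph - 1).
  apply/Bezout_coprimepP; exists (1, -1) => /=.
  have -> : 1 * (ph + 1) + -1 * (ph - 1) = 2%:R%:P by rewrite polyC_natr; ring.
  by rewrite polyC_eqp1 ?pnatr_eq0.
have cAB : coprimep A B.
  apply: (@coprimep_dvdr _ (ph + 1) _ A); first by rewrite eA dvdp_mulr.
  by apply: (@coprimep_dvdl _ (ph - 1) _ B); first by rewrite eB dvdp_mulr.
have qh0 : qh != 0 by rewrite -size_poly_gt0 size_qh; lia.
have [g mg eg] := coprimep_mul_sqr qh0 cAB eAB.
have [h mh eh] : exists2 h, h \is monic & B = lead_coef B *: h ^+ 2.
  by apply: (coprimep_mul_sqr qh0 _ (etrans (mulrC B A) eAB)); rewrite coprimep_sym.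
pose c := lead_coef ph.
have c0 : c != 0 by rewrite lead_coef_eq0 -size_poly_gt0 size_ph addn2.
have lA : lead_coef A = c by rewrite /c -lp1 eA lead_coef_Mmonic.
have lB : lead_coef B = c by rewrite /c -lm1 eB lead_coef_Mmonic.
rewrite lA in eg; rewrite lB in eh.
have e2 : S * (c *: g ^+ 2) - S' * (c *: h ^+ 2) = 2.
  rewrite -eg -eh mulrC -eA [S' * B]mulrC -eB; ring.
have size_sqr (f : {poly R}) : f \is monic -> size (f ^+ 2) = (2 * (size f).-1).+1.
  move=> mf; rewrite mulnC -size_exp prednK // size_poly_gt0.
  by rewrite expf_neq0 ?monic_neq0.
have sA : (size A = (2 * (size g).-1).+1)%N by rewrite eg size_scale // size_sqr.
have sB : (size B = (2 * (size h).-1).+1)%N by rewrite eh size_scale // size_sqr.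
have A0 : A != 0 by rewrite -size_poly_gt0 sA.
have B0 : B != 0 by rewrite -size_poly_gt0 sB.
have sAS : (2 * n + 2 = size A + (size S).-1)%N.
  rewrite -size_ph -sp1 eA size_Mmonic //; move: mS => /monic_neq0.
  by rewrite -size_poly_gt0; case: (size S) => // k _; rewrite addnS.
have sBS : (2 * n + 2 = size B + (size S').-1)%N.
  rewrite -size_ph -sm1 eB size_Mmonic //; move: mS' => /monic_neq0.
  by rewrite -size_poly_gt0; case: (size S') => // k _; rewrite addnS.
have sSS : (5 = (size S + size S').-1)%N.
  by rewrite -size_Mmonic ?monic_neq0 // eSS pell_quarticE size_prod_XsubC.
have [sg0 sh0] : (0 < size g)%N /\ (0 < size h)%N.
  by rewrite !size_poly_gt0 !monic_neq0.
have [sS0 sS'0] : (0 < size S)%N /\ (0 < size S')%N.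
  by rewrite !size_poly_gt0 !monic_neq0.
have : (size S = 2 /\ size S' = 4 /\ size g = n.+1 /\ size h = n \/
        size S = 4 /\ size S' = 2 /\ size g = n /\ size h = n.+1)%N.
  by rewrite sA in sAS; rewrite sB in sBS; exact: splitting_sizes.
case=> -[sS [sS' [sg sh]]].
  exact: (pell_splitting_normalize c0 mg mh mS mS').
(* Here [S] is the cubic factor; swapping the two factors changes the sign of [c]. *)
apply: (@pell_splitting_normalize h g S' S (- c)) => //; first by rewrite oppr_eq0.
  by rewrite mulrC.
by rewrite -e2 !scaleNr !mulrN opprK addrC.
Qed.

(** (S1 p^2 + S3 q^2)^2 - 4 S1 S3 p^2 q^2 is the square of S1 p^2 - S3 q^2, hence 1. This is a Pell
    solution of the same degrees as the given one. *)
Lemma pell_splitting_pell p q S1 S3 : pell_splitting a b l0 n p q S1 S3 ->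
  S1 * p ^+ 2 + S3 * q ^+ 2 = ph \/ S1 * p ^+ 2 + S3 * q ^+ 2 = - ph.
Proof.
move=> [[sp sq sS1 sS3] [m1 m3 eS] heps].
have [e e2 he] : exists2 e : {poly R}, e ^+ 2 = 1 & S1 * p ^+ 2 - S3 * q ^+ 2 = e.
  by case: heps => ->; [exists 1|exists (-1)]; rewrite ?sqrrN ?expr1n.
have [m en] : exists m, n = m.+1 by exists n.-1; rewrite prednK.
have p0 : p != 0 by rewrite -size_poly_gt0 sp.
have q0 : q != 0 by rewrite -size_poly_gt0 sq.
have se : (size e <= 1)%N.
  by case: heps => h; rewrite -he h ?size_polyN size_poly1.
have two (f : {poly R}) : size (f *+ 2) = size f.
  by rewrite -scaler_nat size_scale ?pnatr_eq0.
apply: (@pell_unique _ (pell_quartic a b l0) _ (2 * (p * q)) _ qh (2 * m).+1).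
(* Written as twice [S1 * p ^+ 2] minus a constant, the sum shows its degree. *)
- have -> : S1 * p ^+ 2 + S3 * q ^+ 2 = (S1 * p ^+ 2) *+ 2 - e by rewrite -he; ring.
  have s1 : size (S1 * p ^+ 2)%R = (2 * m).+4.
    rewrite mulrC size_Mmonic ?expf_neq0 // sS1 expr2 size_mul // sp en; lia.
  by rewrite size_polyDl two s1 // size_polyN (leq_ltn_trans se).
- by rewrite size_ph en; lia.
- by rewrite mulr_natl two size_mul // sp sq en; lia.
- by rewrite size_qh en; lia.
- by rewrite -eS -[RHS]e2 -he; ring.
- exact: pell.
Qed.

(** At the root of S1 only S3 q^2 survives, at the other roots only S1 p^2. Their difference is
    constant, so their sum, which is phat up to sign, takes opposite values. *)
Lemma pell_splitting_root p q S1 S3 : pell_splitting a b l0 n p q S1 S3 ->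
  exists r, [/\ S1 = 'X - r%:P, r \in quartic_roots &
    forall z, z \in quartic_roots -> z != r -> ph.[z] = - ph.[r]].
Proof.
move=> spl; have h := pell_splitting_pell spl; move: spl => [[sp sq sS1 sS3] [m1 m3 eS] heps].
have eS1 : S1 = 'X - (- S1`_0)%:P.
  have S11 : S1`_1 = 1 by move/monicP: m1; rewrite lead_coefE sS1.
  apply/polyP => -[|[|i]]; rewrite coefB coefX coefC /= ?subr0 ?sub0r ?opprK //.
  by rewrite nth_default // sS1.
exists (- S1`_0); set r := - S1`_0 in eS1 *.
have r1 : S1.[r] = 0 by rewrite eS1 hornerXsubC subrr.
have rD : r \in quartic_roots.
  by rewrite -root_pell_quartic -eS rootM; apply/orP; left; apply/rootP.
split => // z zD zr.
have z3 : S3.[z] = 0.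
  apply/rootP; move: zD; rewrite -root_pell_quartic -eS rootM => /orP[|//].
  by rewrite eS1 root_XsubC (negPf zr).
have hev w : S1.[w] * p.[w] ^+ 2 + S3.[w] * q.[w] ^+ 2 = ph.[w] /\
    S1.[r] * p.[r] ^+ 2 + S3.[r] * q.[r] ^+ 2 = ph.[r] \/
    S1.[w] * p.[w] ^+ 2 + S3.[w] * q.[w] ^+ 2 = - ph.[w] /\
    S1.[r] * p.[r] ^+ 2 + S3.[r] * q.[r] ^+ 2 = - ph.[r].
  by case: h => h; [left|right]; split; rewrite -?hornerN -h hornerD !hornerM.
have hew : S1.[z] * p.[z] ^+ 2 - S3.[z] * q.[z] ^+ 2 =
    S1.[r] * p.[r] ^+ 2 - S3.[r] * q.[r] ^+ 2.
  have ev w : S1.[w] * p.[w] ^+ 2 - S3.[w] * q.[w] ^+ 2 = (S1 * p ^+ 2 - S3 * q ^+ 2).[w].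
    by rewrite hornerD hornerN !hornerM.
  by rewrite !ev; case: heps => ->; rewrite ?hornerN !hornerC.
move: hew (hev z); rewrite r1 z3 !mul0r subr0 sub0r addr0 add0r => ->.
by case=> [[<- <-]//|[h1 h2]]; apply: oppr_inj; rewrite -h1 -h2.
Qed.

(** If r and r' differed, a third root z would give phat(r) = - phat(z) = phat(r'), against phat(r')
    = - phat(r). *)
Lemma pell_splitting_S1_unique p q S1 S3 p' q' S1' S3' :
  pell_splitting a b l0 n p q S1 S3 -> pell_splitting a b l0 n p' q' S1' S3' ->
  S1 = S1'.
Proof.
move=> /pell_splitting_root[r [-> rD hr]] /pell_splitting_root[r' [-> rD' hr']].
have [->//|rr'] := eqVneq r r'.
have nz z : z \in quartic_roots -> ph.[z] != 0.
  by move/pell_at_root => [] ->; rewrite ?oppr_eq0 oner_neq0.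
have [z [zD zr zr']] : exists z, [/\ z \in quartic_roots, z != r & z != r'].
  have : has (fun z => (z != r) && (z != r')) quartic_roots.
    rewrite -[has _ _]negbK -all_predC; apply/negP => /allP al.
    have : (size quartic_roots <= size [:: r; r'])%N.
      apply: uniq_leq_size => // z /al /=; rewrite negb_and !negbK !inE.
      by case/orP=> ->; rewrite ?orbT.
    by [].
  by case/hasP => z zD /andP[]; exists z.
have h1 := hr z zD zr; have h2 := hr' z zD zr'; have := hr r' rD'.
rewrite eq_sym => /(_ rr') h3; have := nz _ rD.
have : ph.[r] = - ph.[r] by rewrite -h3; apply: oppr_inj; rewrite -h1 -h2.
by move/eqP; rewrite -subr_eq0 opprK -mulr2n mulrn_eq0 /= => ->.
Qed.

(** If both splittings give the same phat, S1 (p'^2 - p^2) is constant, so p'^2 = p^2. If they give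
    opposite ones, p'^2 + p^2 = 0, impossible over the reals. *)
Lemma pell_splitting_unique p q S1 S3 p' q' S1' S3' :
  pell_splitting a b l0 n p q S1 S3 -> pell_splitting a b l0 n p' q' S1' S3' ->
  [/\ p' = p \/ p' = - p, q' = q \/ q' = - q, S1' = S1 & S3' = S3].
Proof.
move=> spl spl'; have eS1 := pell_splitting_S1_unique spl spl'; rewrite -{}eS1 in spl' *.
have eT := pell_splitting_pell spl; have eT' := pell_splitting_pell spl'.
move: spl spl' => [[sp sq sS1 sS3] [m1 m3 eS] heps] [[sp' sq' _ sS3'] [_ m3' eS'] heps'].
have S10 := monic_neq0 m1; have S30 := monic_neq0 m3.
have eS3 : S3' = S3 by apply: (mulfI S10); rewrite eS eS'.
rewrite {}eS3 in eT' heps' sS3' m3' eS' *.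
have se (e : {poly R}) : e = 1 \/ e = - 1 -> (size e <= 1)%N.
  by case=> ->; rewrite ?size_polyN size_poly1.
have S1f0 (f e e' : {poly R}) : (size e <= 1)%N -> (size e' <= 1)%N ->
    S1 * (2%:R *: f) = e + e' -> f = 0.
  move=> s1 s2 h; apply/eqP/negPn/negP => f0.
  have : (size (e + e')%R <= 1)%N by rewrite (leq_trans (size_polyD _ _)) // geq_max s1.
  rewrite -h mulrC size_Mmonic ?scaler_eq0 ?pnatr_eq0 // size_scale ?pnatr_eq0 // sS1.
  by move: f0; rewrite -size_poly_gt0; case: (size f) => // k _; rewrite !addnS.
have lead_gt0 (f : {poly R}) : size f = n.+1 -> 0 < (f ^+ 2)`_(n + n).
  move=> sf; rewrite expr2 coefM_top ?sf // -expr2 exprn_even_gt0 //=.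
  by have /= := lead_coef_eq0 f; rewrite lead_coefE sf /= => ->; rewrite -size_poly_gt0 sf.
have [eTT|eTT] : S1 * p' ^+ 2 + S3 * q' ^+ 2 = S1 * p ^+ 2 + S3 * q ^+ 2 \/
    S1 * p' ^+ 2 + S3 * q' ^+ 2 = - (S1 * p ^+ 2 + S3 * q ^+ 2).
- by case: eT eT' => -> [] ->; rewrite ?opprK; auto.
- have epp : p' ^+ 2 = p ^+ 2.
    apply/eqP; rewrite -subr_eq0; apply/eqP.
    apply: S1f0 (se _ heps') (_ : (size (- (S1 * p ^+ 2 - S3 * q ^+ 2))%R <= 1)%N) _.
      by rewrite size_polyN se.
    rewrite scaler_nat.
    transitivity ((S1 * p' ^+ 2 + S3 * q' ^+ 2) - (S1 * p ^+ 2 + S3 * q ^+ 2) +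
      (S1 * p' ^+ 2 - S3 * q' ^+ 2) - (S1 * p ^+ 2 - S3 * q ^+ 2)); first ring.
    by rewrite eTT; ring.
  split=> //; apply: eq_or_oppr_sqr => //; apply: (mulfI S30).
  by apply: (@addrI _ (S1 * p' ^+ 2)); rewrite eTT epp.
- have := lead_gt0 _ sp; have := lead_gt0 _ sp'.
  have := S1f0 (p' ^+ 2 + p ^+ 2) _ _ (se _ heps') (se _ heps).
  have -> : S1 * (2%:R *: (p' ^+ 2 + p ^+ 2)) =
      S1 * p' ^+ 2 - S3 * q' ^+ 2 + (S1 * p ^+ 2 - S3 * q ^+ 2).
    rewrite scaler_nat; transitivity ((S1 * p' ^+ 2 + S3 * q' ^+ 2) + (S1 * p ^+ 2 + S3 * q ^+ 2) +
      (S1 * p' ^+ 2 - S3 * q' ^+ 2) + (S1 * p ^+ 2 - S3 * q ^+ 2)); first ring.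
    by rewrite eTT; ring.
  move=> /(_ erefl)/(congr1 (fun f : {poly R} => f`_(n + n))).
  by rewrite coefD coef0 => h h1 h2; move: (addr_gt0 h1 h2); rewrite h ltxx.
Qed.

End Splitting.

(** * Billiard trajectories *)

Lemma xycoordP (R : realType) (P Q : 'rV[R]_2) :
  xcoord P = xcoord Q -> ycoord P = ycoord Q -> P = Q.
Proof.
move=> hx hy; apply/rowP => i; have [->|->] : i = 0 \/ i = 1; last 2 first.
- exact: hx.
- exact: hy.
by case: i => [[|[|//]] lt]; [left|right]; apply: val_inj.
Qed.

Section Trajectory.
Variables (R : realType) (a b l0 : R).
Hypotheses (b_gt0 : 0 < b) (ab : b < a) (l0_gt0 : 0 < l0).
Hypotheses (l0a : l0 != a) (l0b : l0 != b).

Let a_gt0 : 0 < a. Proof. exact: lt_trans ab. Qed.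

(** The equation without denominators also covers the degenerate members. *)
Lemma on_confocalP (l : R) (P : 'rV[R]_2) :
  (a - l) * (b - l) = xcoord P ^+ 2 * (b - l) + ycoord P ^+ 2 * (a - l) ->
  on_confocal a b l P.
Proof.
rewrite /on_confocal; have [->|la] := eqVneq l a.
  rewrite subrr mul0r mulr0 addr0 => /esym/eqP; rewrite mulf_eq0 sqrf_eq0 subr_eq0.
  by rewrite (lt_eqF ab) orbF => /eqP.
have [->|lb] := eqVneq l b.
  rewrite subrr !mulr0 add0r => /esym/eqP; rewrite mulf_eq0 sqrf_eq0 subr_eq0.
  by rewrite (gt_eqF ab) orbF => /eqP.
have a0 : a - l != 0 by rewrite subr_eq0 eq_sym.
have b0 : b - l != 0 by rewrite subr_eq0 eq_sym.
move=> h; rewrite addf_div // -h divff // mulf_neq0 //.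
Qed.

(** The coordinates are the roots of a quadratic in l that involves only x^2 and y^2; its
    discriminant [D] vanishes only at the foci. *)
Lemma elliptic_coordinates_exist (P : 'rV[R]_2) :
  ~ (ycoord P = 0 /\ xcoord P ^+ 2 = a - b) ->
  exists l1 l2, forall P' : 'rV[R]_2,
    xcoord P' ^+ 2 = xcoord P ^+ 2 -> ycoord P' ^+ 2 = ycoord P ^+ 2 ->
    elliptic_coordinates a b P' l1 l2.
Proof.
move=> nf; set X := xcoord P ^+ 2; set Y := ycoord P ^+ 2.
have X0 : 0 <= X by apply: sqr_ge0.
have Y0 : 0 <= Y by apply: sqr_ge0.
pose D := (a - b - X + Y) ^+ 2 + 4 * X * Y.
have D0 : 0 < D.
  have XY0 : 0 <= 4 * X * Y by apply: mulr_ge0 => //; apply: mulr_ge0.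
  rewrite lt_neqAle addr_ge0 ?sqr_ge0 // andbT eq_sym paddr_eq0 ?sqr_ge0 //.
  rewrite sqrf_eq0 -mulrA mulf_eq0 pnatr_eq0 /= mulf_eq0; apply/negP => /andP[/eqP h1].
  case/orP => /eqP h; first by move: h1 Y0 ab; rewrite h; lra.
  apply: nf; split; first by apply/eqP; rewrite -sqrf_eq0 -/Y h.
  by rewrite -/X; move: h1; rewrite h; lra.
pose s := Num.sqrt D; have s0 : 0 < s by rewrite sqrtr_gt0.
have s2 : s ^+ 2 = D by rewrite sqr_sqrtr // ltW.
have root e : e ^+ 2 = s ^+ 2 -> let l := (a + b - X - Y + e) / 2 in
    (a - l) * (b - l) = X * (b - l) + Y * (a - l).
  move=> he l; apply/eqP; rewrite -subr_eq0; apply/eqP.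
  have -> : (a - l) * (b - l) - (X * (b - l) + Y * (a - l)) = (e ^+ 2 - D) / 4.
    by rewrite /l /D; field.
  by rewrite he s2 subrr mul0r.
exists ((a + b - X - Y - s) / 2), ((a + b - X - Y + s) / 2) => P' hX hY; split.
- by move: s0; lra.
- by apply: on_confocalP; rewrite hX hY; apply: (root (- s)); rewrite sqrrN.
- by apply: on_confocalP; rewrite hX hY; apply: root.
Qed.

Variable T : nat -> 'rV[R]_2.
Hypothesis T_billiard : billiard_trajectory a b T.
Hypothesis T_caustic : has_caustic a b l0 T.

Let x k := xcoord (T k).
Let y k := ycoord (T k).
Let t k := Num.sqrt (dotp (T k.+1 - T k) (T k.+1 - T k)).
Let u k := xcoord (unit_vector (T k.+1 - T k)).
Let v k := ycoord (unit_vector (T k.+1 - T k)).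
Let r := Num.sqrt (l0 / (a * b)).

Let xcoordE (P Q : 'rV[R]_2) (c : R) : xcoord (c *: (P - Q)) = c * (xcoord P - xcoord Q).
Proof. by rewrite /xcoord !mxE. Qed.
Let ycoordE (P Q : 'rV[R]_2) (c : R) : ycoord (c *: (P - Q)) = c * (ycoord P - ycoord Q).
Proof. by rewrite /ycoord !mxE. Qed.

Lemma segment_length_gt0 k : 0 < t k.
Proof.
case: T_billiard => _ Tne _.
rewrite /t sqrtr_gt0 lt_neqAle addr_ge0 ?sqr_ge0 // andbT eq_sym.
rewrite /dotp -!expr2 paddr_eq0 ?sqr_ge0 // !sqrf_eq0.
apply/negP => /andP[/eqP h1 /eqP h2]; apply: (Tne k).
apply/esym/eqP; rewrite -subr_eq0; apply/eqP.
by apply: xycoordP; rewrite ?h1 ?h2 /xcoord /ycoord mxE.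
Qed.

Lemma x_motion k : x k.+1 = x k + t k * u k.
Proof.
by rewrite /u xcoordE mulrA mulfV ?mul1r ?gt_eqF ?segment_length_gt0 // /x; ring.
Qed.

Lemma y_motion k : y k.+1 = y k + t k * v k.
Proof.
by rewrite /v ycoordE mulrA mulfV ?mul1r ?gt_eqF ?segment_length_gt0 // /y; ring.
Qed.

Lemma uv_unit k : u k ^+ 2 + v k ^+ 2 = 1.
Proof.
have t0 := segment_length_gt0 k.
have h : t k ^+ 2 = dotp (T k.+1 - T k) (T k.+1 - T k).
  by rewrite sqr_sqrtr // addr_ge0 ?sqr_ge0.
apply: (mulfI (expf_neq0 2 (lt0r_neq0 t0))); rewrite mulr1 {2}h.
rewrite mulrDr -!exprMn /u /v /unit_vector -/(t k).
by rewrite /xcoord /ycoord !mxE !mulrA !mulfV ?mul1r ?gt_eqF // /dotp /xcoord /ycoord !mxE.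
Qed.

Let n1 k := x k / a.
Let n2 k := y k / b.
Let m k := - (2 * (u k * n1 k.+1 + v k * n2 k.+1) / (n1 k.+1 * n1 k.+1 + n2 k.+1 * n2 k.+1)).

Lemma uv_bounce k : u k.+1 = u k + m k * x k.+1 / a /\ v k.+1 = v k + m k * y k.+1 / b.
Proof.
case: T_billiard => _ _ /(_ k) h.
have xBZ (P Q : 'rV[R]_2) c : xcoord (P - c *: Q) = xcoord P - c * xcoord Q.
  by rewrite /xcoord !mxE.
have yBZ (P Q : 'rV[R]_2) c : ycoord (P - c *: Q) = ycoord P - c * ycoord Q.
  by rewrite /ycoord !mxE.
have xp (p q : R) : xcoord (point p q) = p by rewrite /xcoord mxE.
have yp (p q : R) : ycoord (point p q) = q by rewrite /ycoord mxE.
rewrite /u /v h /reflect xBZ yBZ /ellipse_normal /m /dotp !xp !yp -/(u k) -/(v k).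
rewrite -/(x k.+1) -/(y k.+1) -/(n1 k.+1) -/(n2 k.+1); split; rewrite !mulNr;
  congr (_ - _); exact: mulrA.
Qed.

Lemma xy_ellipse k : x k ^+ 2 / a + y k ^+ 2 / b = 1.
Proof. by case: T_billiard => /(_ k). Qed.

(** Tangency through the dual conic: the squared distance from the centre to the line equals the
    dual quadratic form at the unit normal (v, - u). *)
Lemma caustic_moment k :
  (x k * v k - y k * u k) ^+ 2 = u k ^+ 2 * (b - l0) + v k ^+ 2 * (a - l0).
Proof.
have [X [Y [Z [nz hc h1 h2]]]] := T_caustic k.
have a0 : a - l0 != 0 by rewrite subr_eq0 eq_sym.
have b0 : b - l0 != 0 by rewrite subr_eq0 eq_sym.
rewrite -/(x k) -/(y k) in h1; rewrite -/(x k.+1) -/(y k.+1) x_motion y_motion in h2.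
have t0 := lt0r_neq0 (segment_length_gt0 k).
have huv : X / (a - l0) * u k + Y / (b - l0) * v k = 0.
  by apply: (mulfI t0); rewrite mulr0 -[RHS](subrr Z) -{1}h2 -h1; ring.
(* The polar line of the tangency point is the trajectory line, so
   [(X / (a - l0), Y / (b - l0)) = c * (v, - u)]. *)
pose c := X / (a - l0) * v k - Y / (b - l0) * u k.
have uv1 := uv_unit k.
have hX : X = c * v k * (a - l0).
  rewrite -[LHS]mulr1 -uv1 /c.
  have -> : X * (u k ^+ 2 + v k ^+ 2) = (a - l0) * (X / (a - l0) * u k * u k + X / (a - l0) * v k ^+ 2) by field.
  have -> : X / (a - l0) * u k = - (Y / (b - l0) * v k) by apply/eqP; rewrite -addr_eq0 huv.
  ring.
have hY : Y = - (c * u k * (b - l0)).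
  rewrite -[LHS]mulr1 -uv1 /c.
  have -> : Y * (u k ^+ 2 + v k ^+ 2) = (b - l0) * (Y / (b - l0) * v k * v k + Y / (b - l0) * u k ^+ 2) by field.
  have -> : Y / (b - l0) * v k = - (X / (a - l0) * u k) by apply/eqP; rewrite -addr_eq0 addrC huv.
  ring.
have hZ : Z = c * (x k * v k - y k * u k).
  by rewrite -h1 hX hY; field; rewrite a0 b0.
have c0 : c != 0.
  by apply/eqP => c0; apply: nz; rewrite hX hY hZ c0 !mul0r oppr0.
apply: (mulfI (expf_neq0 2 c0)); rewrite -exprMn -hZ -hc hX hY; field.
by rewrite a0 b0.
Qed.

Let r2 : r ^+ 2 = l0 / (a * b).
Proof. by rewrite sqr_sqrtr // divr_ge0 ?ltW ?mulr_gt0. Qed.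

Let r_gt0 : 0 < r.
Proof. by rewrite sqrtr_gt0 divr_gt0 ?mulr_gt0. Qed.

Lemma joachimsthal k :
  u k ^+ 2 / a + v k ^+ 2 / b - a^-1 * b^-1 * (x k * v k - y k * u k) ^+ 2 = r ^+ 2.
Proof.
rewrite r2 caustic_moment -[l0 in RHS]mulr1 -(uv_unit k); field.
by rewrite !gt_eqF.
Qed.

(** Both ends on the ellipse give t Q_0(V,V) = - 2 Q_0(P,V), and Lagrange's identity gives
    Q_0(P,V)^2 = r^2. Positivity of t and Q_0(V,V) selects - r. *)
Lemma uv_hit_out k : t k * (u k ^+ 2 / a + v k ^+ 2 / b) = 2 * r /\
  x k * u k / a + y k * v k / b = - r.
Proof.
have t0 := segment_length_gt0 k.
pose al := x k * u k / a + y k * v k / b; pose be := u k ^+ 2 / a + v k ^+ 2 / b.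
have be0 : 0 < be.
  have ua : 0 <= u k ^+ 2 / a by rewrite divr_ge0 ?sqr_ge0 // ltW.
  have vb : 0 <= v k ^+ 2 / b by rewrite divr_ge0 ?sqr_ge0 // ltW.
  rewrite lt_neqAle addr_ge0 // andbT eq_sym paddr_eq0 // !mulf_eq0 !invr_eq0 !orbb.
  rewrite !(gt_eqF a_gt0, gt_eqF b_gt0) !orbF; apply/negP => /andP[/eqP h1 /eqP h2].
  by have := uv_unit k; rewrite h1 h2 !expr0n addr0 => /esym/eqP; rewrite oner_eq0.
have h : t k * be = - (2 * al).
  apply: (mulfI (lt0r_neq0 t0)); apply/eqP; rewrite -subr_eq0; apply/eqP.
  transitivity ((x k.+1 ^+ 2 / a + y k.+1 ^+ 2 / b) - (x k ^+ 2 / a + y k ^+ 2 / b)).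
    by rewrite x_motion y_motion /al /be; ring.
  by rewrite !xy_ellipse subrr.
have al2 : al ^+ 2 = r ^+ 2.
  rewrite -(joachimsthal k).
  transitivity ((x k ^+ 2 / a + y k ^+ 2 / b) * be
      - a^-1 * b^-1 * (x k * v k - y k * u k) ^+ 2); first by rewrite /al /be; ring.
  by rewrite xy_ellipse mul1r.
have al0 : al < 0 by have := mulr_gt0 t0 be0; rewrite h; lra.
case: (eq_or_oppr_sqr al2) => e; first by move: al0 r_gt0; rewrite e; lra.
by rewrite -/al -/be h e; split=> //; ring.
Qed.

(** A line through a focus has squared moment (a - b) v^2, which would force l0 = b. *)
Lemma moving_point_not_focus k s (P := moving_point T k s) :
  ~ (ycoord P = 0 /\ xcoord P ^+ 2 = a - b).
Proof.
have ex : xcoord P = x k + s * t k * u k.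
  rewrite -mulrA -[t k * u k](addrK (x k)) [t k * u k + _]addrC -x_motion.
  rewrite /P /moving_point /x /xcoord !mxE; ring.
have ey : ycoord P = y k + s * t k * v k.
  rewrite -mulrA -[t k * v k](addrK (y k)) [t k * v k + _]addrC -y_motion.
  rewrite /P /moving_point /y /ycoord !mxE; ring.
case=> y0 x2; have := caustic_moment k.
have -> : x k * v k - y k * u k = xcoord P * v k - ycoord P * u k by rewrite ex ey; ring.
rewrite y0 mul0r subr0 exprMn x2 => h.
have : (b - l0) * (u k ^+ 2 + v k ^+ 2) = 0.
  transitivity (u k ^+ 2 * (b - l0) + v k ^+ 2 * (a - l0) - (a - b) * v k ^+ 2); first ring.
  by rewrite -h subrr.
by rewrite uv_unit mulr1 => /eqP; rewrite subr_eq0 eq_sym (negPf l0b).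
Qed.

(** A segment along an axis would make the caustic degenerate. Hence a sign change of a coordinate
    is visible at one end of each segment. *)
Lemma trajectory_leaves_axes k :
  ~ (x k = 0 /\ x k.+1 = 0) /\ ~ (y k = 0 /\ y k.+1 = 0).
Proof.
have t0 := lt0r_neq0 (segment_length_gt0 k).
split=> -[h0 h1].
  have u0 : u k = 0 by apply: (mulfI t0); rewrite mulr0 -h1 x_motion h0 add0r.
  have h := caustic_moment k; rewrite h0 u0 in h.
  have /eqP : a - l0 = 0.
    rewrite -[LHS]mul1r -(uv_unit k) u0.
    transitivity (0 ^+ 2 * (b - l0) + v k ^+ 2 * (a - l0)); first ring.
    by rewrite -h; ring.
  by rewrite subr_eq0 eq_sym (negPf l0a).
have v0 : v k = 0 by apply: (mulfI t0); rewrite mulr0 -h1 y_motion h0 add0r.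
have h := caustic_moment k; rewrite h0 v0 in h.
have /eqP : b - l0 = 0.
  rewrite -[LHS]mul1r -(uv_unit k) v0.
  transitivity (u k ^+ 2 * (b - l0) + 0 ^+ 2 * (a - l0)); first ring.
  by rewrite -h; ring.
by rewrite subr_eq0 eq_sym (negPf l0b).
Qed.

Variables (n : nat) (ph qh : {poly R}).
Hypothesis n_gt0 : (0 < n)%N.
Hypothesis size_ph : size ph = (2 * n + 2)%N.
Hypothesis size_qh : size qh = (2 * n)%N.
Hypothesis pell : ph ^+ 2 - pell_quartic a b l0 * qh ^+ 2 = 1.

Lemma trajectory_return0 :
  xcoord (T (2 * n + 1)%N) = ph.[0] * ph.[a^-1] * xcoord (T 0) /\
  ycoord (T (2 * n + 1)%N) = ph.[0] * ph.[b^-1] * ycoord (T 0).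
Proof.
have sph : size ph = (2 * n + 1).+1 by rewrite size_ph addnS.
have sqh : size qh = (2 * n + 1).-1 by rewrite size_qh addn1.
have N1 : (1 < 2 * n + 1)%N by rewrite addn1 ltnS muln_gt0.
have ilr : l0^-1 * r ^+ 2 = a^-1 * b^-1.
  by rewrite r2 mulKf ?gt_eqF // invfM.
(* Pell involves only the square of [qh], so its sign may be chosen to match the leading coefficient
   of [ph]. *)
have main (q : {poly R}) : size q = (2 * n + 1).-1 -> q ^+ 2 = qh ^+ 2 ->
    ph`_(2 * n + 1) = q`_(2 * n + 1 - 2) ->
    xcoord (T (2 * n + 1)%N) = ph.[0] * ph.[a^-1] * xcoord (T 0) /\
    ycoord (T (2 * n + 1)%N) = ph.[0] * ph.[b^-1] * ycoord (T 0).
  move=> sq eq lead.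
  have pq : ph ^+ 2 - pell_quartic a b l0 * q ^+ 2 = 1 by rewrite eq.
  exact: (orbit_return r_gt0 ilr x_motion y_motion
    (fun k => proj1 (uv_bounce k)) (fun k => proj2 (uv_bounce k)) xy_ellipse uv_unit
    (fun k => proj2 (uv_hit_out k)) (fun k => proj1 (uv_hit_out k)) joachimsthal
    N1 sph sq lead pq).
have mD : pell_quartic a b l0 \is monic by rewrite pell_quarticE monic_prod_XsubC.
have q20 : qh ^+ 2 != 0.
  by rewrite expf_neq0 // -size_poly_gt0 size_qh muln_gt0.
have lead2 : lead_coef ph ^+ 2 = lead_coef qh ^+ 2.
  rewrite -!lead_coef_exp.
  rewrite -[ph ^+ 2](subrK (pell_quartic a b l0 * qh ^+ 2)) pell lead_coefDr.
    by rewrite lead_coef_monicM.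
  rewrite size_poly1 mulrC size_Mmonic // pell_quarticE size_prod_XsubC addnS /= addnS.
  by rewrite ltnS addn_gt0 orbT.
have eN : (2 * n + 1 - 2)%N = (2 * n).-1 by rewrite addn1 -subn1 !subSS.
have [e|e] : ph`_(2 * n + 1) = qh`_(2 * n + 1 - 2) \/ ph`_(2 * n + 1) = - qh`_(2 * n + 1 - 2).
- rewrite eN; move: (eq_or_oppr_sqr lead2).
  by rewrite !lead_coefE size_ph size_qh addn2 addn1.
- exact: (main qh sqh erefl e).
- by apply: (main (- qh)); rewrite ?size_polyN ?sqrrN ?coefN.
Qed.

End Trajectory.

(** * Return after 2n+1 bounces from any vertex *)

Section Periodicity.
Variables (R : realType) (a b l0 : R).
Hypotheses (b_gt0 : 0 < b) (ab : b < a) (l0_gt0 : 0 < l0).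
Hypotheses (l0a : l0 != a) (l0b : l0 != b).
Variables (n : nat) (ph qh : {poly R}).
Hypothesis n_gt0 : (0 < n)%N.
Hypothesis size_ph : size ph = (2 * n + 2)%N.
Hypothesis size_qh : size qh = (2 * n)%N.
Hypothesis pell : ph ^+ 2 - pell_quartic a b l0 * qh ^+ 2 = 1.
Variable T : nat -> 'rV[R]_2.
Hypothesis T_billiard : billiard_trajectory a b T.
Hypothesis T_caustic : has_caustic a b l0 T.

Let g1 := ph.[0] * ph.[a^-1].
Let g2 := ph.[0] * ph.[b^-1].

(** A shifted trajectory is again a trajectory with the same caustic. *)
Lemma trajectory_return k :
  xcoord (T (k + (2 * n + 1))%N) = g1 * xcoord (T k) /\
  ycoord (T (k + (2 * n + 1))%N) = g2 * ycoord (T k).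
Proof.
have sB : billiard_trajectory a b (fun j => T (j + k)%N).
  by case: T_billiard => h1 h2 h3; split=> j; [exact: h1|exact: h2|exact: h3].
have sC : has_caustic a b l0 (fun j => T (j + k)%N) by move=> j; apply: T_caustic.
rewrite addnC.
exact: (trajectory_return0 b_gt0 ab l0_gt0 l0a l0b sB sC n_gt0 size_ph size_qh pell).
Qed.

Lemma pell_at_root_sqr z : z \in quartic_roots a b l0 -> ph.[z] ^+ 2 = 1.
Proof. by move=> /(pell_at_root pell)[] ->; rewrite ?sqrrN expr1n. Qed.

(** Both ends of a segment undergo the same axial symmetry, so the moving point keeps x^2 and
    y^2. *)
Lemma trajectory_elliptic_periodic : elliptic_periodic a b (2 * n + 1) T.
Proof.
move=> k t _.
have [x1 y1] := trajectory_return k; have [x2 y2] := trajectory_return k.+1.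
have [l1 [l2 h]] := elliptic_coordinates_exist ab
  (moving_point_not_focus l0a l0b T_billiard T_caustic (k := k) (s := t)).
have s0 : ph.[0] ^+ 2 = 1 by rewrite pell_at_root_sqr // !inE eqxx.
have sa : ph.[a^-1] ^+ 2 = 1 by rewrite pell_at_root_sqr // !inE eqxx orbT.
have sb : ph.[b^-1] ^+ 2 = 1 by rewrite pell_at_root_sqr // !inE eqxx !orbT.
have xm j : xcoord (moving_point T j t) = (1 - t) * xcoord (T j) + t * xcoord (T j.+1).
  by rewrite /moving_point /xcoord !mxE.
have ym j : ycoord (moving_point T j t) = (1 - t) * ycoord (T j) + t * ycoord (T j.+1).
  by rewrite /moving_point /ycoord !mxE.
exists l1, l2; split; apply: h => //.
  rewrite !xm x1 -addSn x2 !(mulrCA _ g1) -mulrDr exprMn.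
  by rewrite /g1 exprMn s0 sa !mul1r.
rewrite !ym y1 -addSn y2 !(mulrCA _ g2) -mulrDr exprMn.
by rewrite /g2 exprMn s0 sb !mul1r.
Qed.

(** A factor [g1] or [g2] other than 1 would force the corresponding coordinate to vanish at two
    consecutive vertices. *)
Lemma trajectory_periodicE :
  periodic (2 * n + 1) T <-> ph.[a^-1] = ph.[0] /\ ph.[b^-1] = ph.[0].
Proof.
have s0 : ph.[0] ^+ 2 = 1 by rewrite pell_at_root_sqr // !inE eqxx.
have g_id z : ph.[0] * ph.[z] = 1 -> ph.[z] = ph.[0].
  by move=> h; rewrite -[LHS]mul1r -s0 expr2 -mulrA h mulr1.
split=> [per|[ea eb] k]; last first.
  have [hx hy] := trajectory_return k.
  rewrite /g1 /g2 ea eb -!expr2 s0 !mul1r in hx hy.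
  exact: xycoordP.
have [nx ny] := trajectory_leaves_axes l0a l0b T_billiard T_caustic 0.
have fixed (g z : R) : z = g * z -> g <> 1 -> z = 0.
  move=> h gn; apply/eqP; have : (g - 1) * z = 0 by rewrite mulrBl -h mul1r subrr.
  by move/eqP; rewrite mulf_eq0 subr_eq0 => /orP[/eqP|].
have hx k : xcoord (T k) = g1 * xcoord (T k) by rewrite -(proj1 (trajectory_return k)) per.
have hy k : ycoord (T k) = g2 * ycoord (T k) by rewrite -(proj2 (trajectory_return k)) per.
split; apply: g_id.
  by have [//|/eqP g] := eqVneq g1 1; case: nx; split; apply: fixed (hx _) g.
by have [//|/eqP g] := eqVneq g2 1; case: ny; split; apply: fixed (hy _) g.
Qed.

End Periodicity.

Theorem theorem3p5 (R : realType) (a b l0 : R) (n : nat) (phat qhat : {poly R})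
  (hb : 0 < b) (hab : b < a)
  (hl0 : 0 < l0 < b \/ b < l0 < a)
  (hn : (1 <= n)%N)
  (hphat : size phat = (2 * n + 2)%N)
  (hqhat : size qhat = (2 * n)%N)
  (hpell : phat ^+ 2 - pell_quartic a b l0 * qhat ^+ 2 = 1) :
  exists p q S1 S3 : {poly R},
    [/\ pell_splitting a b l0 n p q S1 S3,
        forall p' q' S1' S3' : {poly R},
          pell_splitting a b l0 n p' q' S1' S3' ->
          [/\ p' = p \/ p' = - p, q' = q \/ q' = - q, S1' = S1 & S3' = S3],
        forall T : nat -> 'rV[R]_2,
          billiard_trajectory a b T -> has_caustic a b l0 T ->
          elliptic_periodic a b (2 * n + 1) T &
        forall T : nat -> 'rV[R]_2,
          billiard_trajectory a b T -> has_caustic a b l0 T ->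
          (periodic (2 * n + 1) T <-> S1 = 'X - (l0^-1)%:P)].
Proof.
have l0_gt0 : 0 < l0 by case: hl0 => /andP[] // /(lt_trans hb).
have l0a : l0 != a.
  by case: hl0 => /andP[h1 h2]; rewrite lt_eqF // (lt_trans h2).
have l0b : l0 != b by case: hl0 => /andP[h1 h2]; rewrite ?(lt_eqF h2) ?(gt_eqF h1).
have a_gt0 : 0 < a := lt_trans hb hab.
have uniq_roots : uniq (quartic_roots a b l0).
  rewrite /= !inE !(inj_eq invr_inj) ![0 == _]eq_sym !invr_eq0.
  rewrite (gt_eqF a_gt0) (gt_eqF hb) (gt_eqF l0_gt0) (gt_eqF hab).
  by rewrite ![_ == l0]eq_sym (negPf l0a) (negPf l0b).
have [p [q [S1 [S3 spl]]]] := pell_splitting_exists uniq_roots hn hphat hqhat hpell.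
exists p, q, S1, S3; split=> //.
- by move=> p' q' S1' S3'; apply: (pell_splitting_unique uniq_roots hn hphat hqhat hpell spl).
- by move=> T hT hC; apply: (trajectory_elliptic_periodic hb hab l0_gt0 l0a l0b hn hphat hqhat hpell hT hC).
move=> T hT hC.
have [r [-> rD hr]] := pell_splitting_root uniq_roots hn hphat hqhat hpell spl.
have [h1 h2] := trajectory_periodicE hb hab l0_gt0 l0a l0b hn hphat hqhat hpell hT hC.
have neg_neq z : z \in quartic_roots a b l0 -> phat.[z] <> - phat.[z].
  by move=> /(pell_at_root hpell)[] -> e; lra.
have z0 : 0 \in quartic_roots a b l0 by rewrite !inE eqxx.
have za : a^-1 \in quartic_roots a b l0 by rewrite !inE eqxx orbT.
have zb : b^-1 \in quartic_roots a b l0 by rewrite !inE eqxx !orbT.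
split=> [/h1[ea eb]|/(congr1 (fun S : {poly R} => S`_0))].
  have a0 : a^-1 != 0 by rewrite invr_eq0 gt_eqF.
  have b0 : b^-1 != 0 by rewrite invr_eq0 gt_eqF.
  (* Were [r] one of 0, 1/a, 1/b, [phat] would take opposite values at two of these points, against
     [ea] and [eb]. *)
  move: rD; rewrite !inE => /or4P[] /eqP er //; last by rewrite er.
  - by case: (neg_neq 0 z0); rewrite -[LHS]ea hr ?er.
  - by case: (neg_neq _ za); rewrite [LHS]ea hr ?er // eq_sym.
  - by case: (neg_neq _ zb); rewrite [LHS]eb hr ?er // eq_sym.
rewrite !coefB !coefX !coefC /= !sub0r => /oppr_inj er.
rewrite er in hr.
have h0 : phat.[0] = - phat.[l0^-1] by apply: hr; rewrite // eq_sym invr_eq0 gt_eqF.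
apply: h2; rewrite h0; split; apply: hr; rewrite // (inj_eq invr_inj) eq_sym.
  exact: l0a.
exact: l0b.
Qed.
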